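(* Let $\mu$ be a positive Borel measure on $\mathbb{R}^{N}$ with compact support and let $(T_{n})_{n}$ be a sequence of sublinear and monotone operators from the Banach lattice $L^{p}(\mu)$ into itself, where $p\in[1,\infty)$. If $M=\sup_{n}\|T_{n}\|<\infty$ and $$T_{n}(f)\rightarrow f\quad\text{in } p\text{-mean}$$ for each of the test functions $f\in\{1,\ \pm\mathrm{pr}_{1},\ldots,\pm\mathrm{pr}_{N},\ \sum_{k=1}^{N}\mathrm{pr}_{k}^{2}\}$, then this convergence occurs for all nonnegative functions $f\in L^{p}(\mu)$. It occurs for all functions in $L^{p}(\mu)$ provided that the operators $T_{n}$ are weakly nonlinear and monotone.
   Context: Convergence in $p$-mean is convergence in the norm of $L^{p}(\mu)$. $\mathrm{pr}_{k}$ denotes the $k$-th coordinate function $x=(x_1,\ldots,x_N)\mapsto x_k$, and $1$ is the constant function (all these are regarded as elements of $L^p(\mu)$). $L^p(\mu)$ carries the usual almost everywhere ordering. An operator $T:L^p(\mu)\to L^p(\mu)$ (not assumed linear) is sublinear if $T(f+g)\leq T(f)+T(g)$ and $T(\alpha f)=\alpha T(f)$ for all $f,g$ and all $\alpha\geq0$; monotone if $f\leq g$ implies $T(f)\leq T(g)$; translatable if $T(f+\alpha\cdot1)=T(f)+\alpha T(1)$ for all $f$ and all $\alpha\geq0$; weakly nonlinear if it is sublinear and translatable. The norm of a sublinear (continuous) operator is $\|T\|=\sup\{\|T(f)\|_{L^p}:\|f\|_{L^p}\leq1\}$; sublinear monotone operators between Banach lattices are automatically continuous. *)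

(* Defs.v *)
From HB Require Import structures.
From mathcomp Require Import all_boot all_order all_algebra finmap.
From mathcomp Require Import all_classical all_reals all_analysis.
From mathcomp Require Import measurable_realfun lebesgue_integral hoelder ess_sup_inf.

Set Implicit Arguments.
Unset Strict Implicit.
Unset Printing Implicit Defensive.

Import Order.TTheory GRing.Theory Num.Theory.
Import numFieldNormedType.Exports.

Local Open Scope classical_set_scope.
Local Open Scope ring_scope.

(* [LspaceType mu p1] is the library's type of a.e.-equality classes, but it
   comes without algebraic structure; we make it a vector space, with the
   operations computed on representatives. *)
Section Lspace_lmodule.
Context d (T : measurableType d) (R : realType).
Variables (mu : {measure set T -> \bar R}) (p : \bar R) (p1 : (1 <= p)%E).
Local Notation L := (LspaceType mu p1).
Local Open Scope quotient_scope.

Lemma ae_eq_Lnorm (f g : T -> R) :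
  measurable_fun setT f -> measurable_fun setT g -> f = g %[ae mu] ->
  ('N[mu]_p[EFin \o f] = 'N[mu]_p[EFin \o g])%E.
Proof.
move=> mf mg fg; rewrite unlock; move: p1; case: p => [r r1| |//].
- have mpow (h : T -> R) : measurable_fun setT h ->
      measurable_fun setT (fun x => (`|(EFin \o h) x| `^ r)%E).
    move=> mh; apply/measurable_EFinP.
    apply: (@measurableT_comp _ _ _ _ _ _ (@powR R ^~ r)) => //.
    exact: measurableT_comp.
  apply: (congr1 (fun z => poweR z r^-1)); apply: ae_eq_integral => //; [exact: mpow|exact: mpow|].
  by apply: filterS fg => x /= fgx _; rewrite fgx.
- move=> _; case: ifPn => // mu0; apply: eq_ess_sup.
  by apply: filterS fg => x /= ->.
Qed.

Lemma Lspace_measurable (f : L) : measurable_fun setT (f : T -> R).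
Proof.
exact: (@measurable_funPT _ _ _ _
  (repr (f : {mfun_ mu, T >-> measurableTypeR R}))).
Qed.

Lemma Lspace_Lfun (f : L) : (f : T -> R) \in Lfun mu p.
Proof.
apply/andP; split; rewrite inE /=; first exact: Lspace_measurable.
exact: Lebesgue_finite.
Qed.

Lemma Lspace_eqP (f g : L) : (f : T -> R) = (g : T -> R) %[ae mu] <-> f = g.
Proof.
split=> [fg|->]; last exact: ae_eq_refl.
have : LebesgueSpace.sort f = LebesgueSpace.sort g.
  by rewrite -[LHS]reprK -[RHS]reprK; apply/eqmodP/asboolP.
case: f g {fg} => [f [[cf]]] [g [[cg]]] /= fg.
by move: cf cg; rewrite fg => cf cg; rewrite (Prop_irrelevance cf cg).
Qed.

Definition Lrepr (f : L) : LfunType mu p1 := Lfun_Sub p1 (Lspace_Lfun f).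

Section Lclass.
Variable f : LfunType mu p1.

Let fR : T -> measurableTypeR R := f.

Let measurable_fR : measurable_fun setT fR.
Proof. exact: (@measurable_funPT _ _ _ _ f). Qed.

#[local] HB.instance Definition _ := isMeasurableFun.Build _ _ _ _ fR measurable_fR.

Let piR : {mfun_ mu, T >-> measurableTypeR R} :=
  \pi_({mfun_ mu, T >-> measurableTypeR R}) fR.

Let piR_ae : (piR : T -> R) = (f : T -> R) %[ae mu].
Proof. by have /eqmodP/asboolP := reprK piR. Qed.

Let piR_finite : finite_norm mu p piR.
Proof.
have := @Lfunction_finite _ _ _ _ _ _ f; rewrite /finite_norm.
congr (_ < _)%E; apply: ae_eq_Lnorm; [exact: measurable_fR| |].
- exact: (@measurable_funPT _ _ _ _ (repr piR)).
- exact: ae_eq_sym.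
Qed.

#[local] HB.instance Definition _ := isFinLebesgue.Build _ T R mu p p1 piR piR_finite.

Definition Lclass : L := piR.

Lemma Lclass_ae : (Lclass : T -> R) = (f : T -> R) %[ae mu].
Proof. exact: piR_ae. Qed.

End Lclass.

#[local] Opaque Lclass.

Definition Lzero : L := Lclass 0.
Definition Ladd (f g : L) : L := Lclass (Lrepr f + Lrepr g).
Definition Lopp (f : L) : L := Lclass (- Lrepr f).
Definition Lscale (a : R) (f : L) : L := Lclass (a *: Lrepr f).

Let Lzero_ae : {ae mu, forall x, Lzero x = 0}.
Proof. by apply: filterS (Lclass_ae 0) => x /(_ I). Qed.

Let Ladd_ae f g : {ae mu, forall x, Ladd f g x = (f x : R) + g x}.
Proof. by apply: filterS (Lclass_ae (Lrepr f + Lrepr g)) => x /(_ I). Qed.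

Let Lopp_ae f : {ae mu, forall x, Lopp f x = - (f x : R)}.
Proof. by apply: filterS (Lclass_ae (- Lrepr f)) => x /(_ I). Qed.

Let Lscale_ae a f : {ae mu, forall x, Lscale a f x = a * (f x : R)}.
Proof. by apply: filterS (Lclass_ae (a *: Lrepr f)) => x /(_ I). Qed.

HB.instance Definition _ := gen_eqMixin L.
HB.instance Definition _ := gen_choiceMixin L.

Let LaddA : associative Ladd.
Proof.
move=> f g h; apply/Lspace_eqP.
near=> x => _; rewrite (near (Ladd_ae f (Ladd g h)) x)//.
rewrite (near (Ladd_ae g h) x)// (near (Ladd_ae (Ladd f g) h) x)//.
by rewrite (near (Ladd_ae f g) x)// addrA.
Unshelve. all: by end_near. Qed.

Let LaddC : commutative Ladd.
Proof.
move=> f g; apply/Lspace_eqP.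
near=> x => _; rewrite (near (Ladd_ae f g) x)// (near (Ladd_ae g f) x)//.
by rewrite addrC.
Unshelve. all: by end_near. Qed.

Let Ladd0 : left_id Lzero Ladd.
Proof.
move=> f; apply/Lspace_eqP.
near=> x => _; rewrite (near (Ladd_ae Lzero f) x)// (near Lzero_ae x)//.
by rewrite add0r.
Unshelve. all: by end_near. Qed.

Let LaddN : left_inverse Lzero Lopp Ladd.
Proof.
move=> f; apply/Lspace_eqP.
near=> x => _; rewrite (near (Ladd_ae (Lopp f) f) x)// (near (Lopp_ae f) x)//.
by rewrite (near Lzero_ae x)// addNr.
Unshelve. all: by end_near. Qed.

HB.instance Definition _ := GRing.isZmodule.Build L LaddA LaddC Ladd0 LaddN.

Let LscaleA a b f : Lscale a (Lscale b f) = Lscale (a * b) f.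
Proof.
apply/Lspace_eqP.
near=> x => _; apply: etrans (near (Lscale_ae a (Lscale b f)) x _) _ => //.
apply: etrans _ (esym (near (Lscale_ae (a * b) f) x _)) => //.
apply: etrans (congr1 ( *%R a) (near (Lscale_ae b f) x _)) _ => //.
by rewrite mulrA.
Unshelve. all: by end_near. Qed.

Let Lscale1 : left_id 1 Lscale.
Proof.
move=> f; apply/Lspace_eqP.
by near=> x => _; rewrite (near (Lscale_ae 1 f) x)// mul1r.
Unshelve. all: by end_near. Qed.

Let LscaleDr : right_distributive Lscale +%R.
Proof.
move=> a f g; apply/Lspace_eqP.
near=> x => _; rewrite (near (Lscale_ae a (f + g)) x)//.
rewrite (near (Ladd_ae f g) x)// (near (Ladd_ae (Lscale a f) (Lscale a g)) x)//.
rewrite (near (Lscale_ae a f) x)// (near (Lscale_ae a g) x)//.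
by rewrite mulrDr.
Unshelve. all: by end_near. Qed.

Let LscaleDl f : {morph Lscale^~ f : a b / a + b}.
Proof.
move=> a b; apply/Lspace_eqP.
near=> x => _; apply: etrans (near (Lscale_ae (a + b) f) x _) _ => //.
apply: etrans _ (esym (near (Ladd_ae (Lscale a f) (Lscale b f)) x _)) => //.
apply: etrans _ (esym (congr2 +%R (near (Lscale_ae a f) x _)
                                  (near (Lscale_ae b f) x _))) => //.
by rewrite mulrDl.
Unshelve. all: by end_near. Qed.

HB.instance Definition _ := GRing.Zmodule_isLmodule.Build R L
  LscaleA Lscale1 LscaleDr LscaleDl.

Lemma Lspace0_ae : {ae mu, forall x, (0 : L) x = 0 :> R}.
Proof. exact: Lzero_ae. Qed.

Lemma LspaceD_ae (f g : L) :
  {ae mu, forall x, (f + g) x = (f x : R) + (g x : R)}.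
Proof. exact: Ladd_ae. Qed.

Lemma LspaceN_ae (f : L) : {ae mu, forall x, (- f) x = - (f x : R)}.
Proof. exact: Lopp_ae. Qed.

Lemma LspaceZ_ae (a : R) (f : L) :
  {ae mu, forall x, (a *: f) x = a * (f x : R)}.
Proof. exact: Lscale_ae. Qed.

(* The almost everywhere ordering. *)
Definition Lle (f g : L) : Prop := {ae mu, forall x, ((f x : R) <= g x)%R}.

End Lspace_lmodule.

(* R^N with the sigma-algebra generated by the topology of 'rV[R]_N. *)
Definition borel_rV (R : realType) (N : nat) :=
  g_sigma_algebraType (@open 'rV[R]_N).

Section borel_rV.
Context (R : realType) (N : nat).
Local Notation E := (borel_rV R N).

Lemma open_borel_rV (U : set 'rV[R]_N) : open U -> measurable (U : set E).
Proof. exact: sub_sigma_algebra. Qed.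

Lemma closed_borel_rV (F : set 'rV[R]_N) : closed F -> measurable (F : set E).
Proof.
by move=> /closed_openC/open_borel_rV/measurableC; rewrite setCK.
Qed.

Lemma continuous_borel_rV (f : 'rV[R]_N -> R) :
  continuous f -> measurable_fun setT (f : E -> R).
Proof.
move=> /continuousP cf; apply: (measurability _ (RGenOpens.measurableE R)).
move=> _ [_ [a [b ->] <-]]; rewrite setTI.
by apply: open_borel_rV; apply: cf; exact: interval_open.
Qed.

(* The support is the complement of the union of all open null sets. *)
Definition msupport (mu : {measure set E -> \bar R}) : set 'rV[R]_N :=
  [set x | forall U : set 'rV[R]_N, open U -> U x -> (0 < mu U)%E].

Lemma closed_msupport (mu : {measure set E -> \bar R}) : closed (msupport mu).
Proof.
rewrite -[msupport mu]setCK; apply: open_closedC.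
rewrite openE => x /= /existsNP[U] /not_implyP[oU] /not_implyP[Ux muU].
apply: filterS (open_nbhs_nbhs (conj oU Ux)) => y Uy /(_ U oU Uy).
exact: muU.
Qed.

Lemma msupport_null (mu : {measure set E -> \bar R}) :
  (mu (~` msupport mu) = 0)%E.
Proof.
set S := msupport mu.
pose K n : set 'rV[R]_N := [set x | `|x| <= n%:R] `&`
  ~` \bigcup_(y in S) ball y n.+1%:R^-1.
have cK n : closed (K n).
  apply: closedI.
    apply: (@preimage_closed _ _ (fun x : 'rV[R]_N => `|x|) [set r | r <= n%:R]).
      by move=> x _; exact: norm_continuous.
    exact: closed_le.
  apply: open_closedC; apply: bigcup_open => y _; exact: ball_open.
have KS n : K n `<=` ~` S.
  move=> x [_ /= xS] Sx; apply: xS; exists x => //; exact: ballxx.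
have K0 n : mu (K n) = 0%E.
  have : compact (K n).
    apply: bounded_closed_compact (cK n).
    exists n%:R; split=> // M nM x [/= xn _]; exact: le_trans xn (ltW nM).
  rewrite compact_cover => /(_ _ [set U | open U /\ mu U = 0%E] id).
  case=> [U []//| x /KS/= /existsNP[U] /not_implyP[oU] /not_implyP[Ux muU]|].
    exists U => //; split=> //; apply/eqP.
    by rewrite eq_le measure_ge0 andbT leNgt; apply/negP.
  move=> D DU KD.
  have mD U : U \in D -> measurable (U : set E).
    by move=> /DU; rewrite inE => -[oU _]; exact: open_borel_rV.
  have : mu.-negligible (cover [set` D] id).
    rewrite /cover bigcup_fset big_seq; elim/big_ind: _.
    - exact: negligible_set0.
    - by move=> A B; exact: negligibleU.
    - move=> U UD; apply/negligibleP; first by exact: mD.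
      by have := DU _ UD; rewrite inE => -[].
  move=> nD; apply/(negligibleP mu (closed_borel_rV (cK n))).
  have [A [mA A0 DA]] := nD; exists A; split=> //.
  exact: subset_trans KD DA.
have -> : ~` S = \bigcup_n K n.
  apply/seteqP; split=> [x Sx|x [n _ Kx]]; last exact: KS Kx.
  have : nbhs x (~` S).
    by apply: open_nbhs_nbhs; split=> //; exact/closed_openC/closed_msupport.
  move=> /nbhs_ballP[e /= e0 eS].
  exists (maxn (Num.truncn `|x|).+1 (Num.truncn e^-1)) => //; split=> /=.
    apply: (le_trans (ltW (truncnS_gt _))).
    by rewrite ler_nat leq_maxl.
  move=> [y Sy /=] /ball_sym xy; apply: (eS y) => //; apply: le_ball xy.
  rewrite invf_ple ?posrE//; apply: (le_trans (ltW (truncnS_gt _))).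
  by rewrite ler_nat ltnS leq_maxr.
apply/negligibleP.
  by apply: bigcup_measurable => n _; exact: closed_borel_rV.
apply: negligible_bigcup => n; apply/negligibleP; last exact: K0.
exact: closed_borel_rV.
Qed.

Lemma msupport_ae (mu : {measure set E -> \bar R}) :
  {ae mu, forall x, msupport mu x}.
Proof.
apply/negligibleP; last exact: msupport_null.
by apply: open_borel_rV; apply: closed_openC; exact: closed_msupport.
Qed.

Lemma continuous_Lfun (mu : {finite_measure set E -> \bar R}) (p : R)
    (p1 : (1 <= p%:E)%E) (f : 'rV[R]_N -> R) :
  compact (msupport mu) -> continuous f -> (f : E -> R) \in Lfun mu p%:E.
Proof.
move=> cS cf.
have p0 : 0 <= p by apply: le_trans ler01 _; rewrite -lee_fin.
have mf := continuous_borel_rV cf.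
have [M [Mreal fM]] : bounded_set (f @` msupport mu).
  by apply: compact_bounded; apply: continuous_compact => //;
    exact: continuous_subspaceT.
pose C := `|M| + 1.
have fC x : msupport mu x -> `|f x| <= C.
  by move=> Sx; apply: (fM C); [rewrite /C ltr_pwDr// ler_norm|exists x].
apply/andP; split; rewrite inE//= /finite_norm unlock poweR_lty//.
apply: (@le_lt_trans _ _ (\int[mu]_x (C `^ p)%:E)%E); last first.
  rewrite integral_cst// ltey_eq fin_numM//; exact: fin_num_measure.
apply: ae_ge0_le_integral => //.
- by move=> x _; rewrite lee_fin powR_ge0.
- apply/measurable_EFinP.
  apply: (@measurableT_comp _ _ _ _ _ _ (@powR R ^~ p)) => //.
  exact: measurableT_comp.
- by move=> x _; rewrite lee_fin powR_ge0.
- have [A [mA A0 SA]] := msupport_ae mu; exists A; split=> // x /= nx.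
  apply: SA => /= Sx; apply: nx => _.
  rewrite lee_fin ge0_ler_powR ?nnegrE//; last exact: fC.
  exact: le_trans (normr_ge0 _) (fC _ Sx).
Qed.

End borel_rV.

(* Finiteness of [mu] is what makes the constant function 1 an element of
   L^p(mu); operators [A] are arbitrary maps, not assumed linear. *)
Section operators.
Context d (T : measurableType d) (R : realType).
Variables (mu : {finite_measure set T -> \bar R}) (p : R).
Variable p1 : (1 <= p%:E)%E.
Local Notation L := (LspaceType mu p1).
Implicit Type A : L -> L.

Definition Lpnorm (f : L) : \bar R := 'N[mu]_(p%:E)[EFin \o (f : T -> R)]%E.

Definition Lone : L := Lclass (Lfun_Sub p1 (Lfun_cst mu 1 p)).

Definition op_sublinear A :=
  (forall f g : L, Lle (A (f + g)) (A f + A g)) /\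
  (forall (a : R) (f : L), 0 <= a -> A (a *: f) = a *: A f).

Definition op_monotone A := forall f g : L, Lle f g -> Lle (A f) (A g).

Definition op_translatable A :=
  forall (f : L) (a : R), 0 <= a -> A (f + a *: Lone) = A f + a *: A Lone.

Definition weakly_nonlinear A := op_sublinear A /\ op_translatable A.

Definition opnorm A : \bar R :=
  ereal_sup [set Lpnorm (A f) | f in [set f : L | (Lpnorm f <= 1)%E]].

Definition cvg_pmean (u : nat -> L) (f : L) :=
  Lpnorm (u n - f) @[n --> \oo] --> 0%E.

End operators.

Section test_functions.
Context (R : realType) (N : nat).
Local Notation E := (borel_rV R N).

Definition pr (k : 'I_N) (x : 'rV[R]_N) : R := x ord0 k.

Definition sum_pr2 (x : 'rV[R]_N) : R := \sum_(k < N) pr k x ^+ 2.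

Lemma continuous_pr k : continuous (pr k).
Proof. by move=> x; exact: coord_continuous. Qed.

Lemma continuous_sum_pr2 : continuous sum_pr2.
Proof.
apply: continuous_big => [|k _ x]; first exact: add_continuous.
have cx := @continuous_pr k x; exact: (cvgM cx cx).
Qed.

Variables (mu : {finite_measure set E -> \bar R}) (p : R).
Variables (p1 : (1 <= p%:E)%E) (cS : compact (msupport mu)).
Local Notation L := (LspaceType mu p1).

Definition Lpr (k : 'I_N) : L :=
  Lclass (Lfun_Sub p1 (continuous_Lfun p1 cS (@continuous_pr k))).

Definition Lsum_pr2 : L :=
  Lclass (Lfun_Sub p1 (continuous_Lfun p1 cS continuous_sum_pr2)).

Definition test_functions : set L :=
  [set Lone mu p1] `|` range Lpr `|` range (fun k => - Lpr k) `|` [set Lsum_pr2].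

End test_functions.

(* Main.v *)
Require Import Defs.
From mathcomp Require Import all_boot all_order all_algebra.
From mathcomp Require Import all_classical all_reals all_analysis.
From mathcomp Require Import measurable_realfun.
From mathcomp Require Import ring.

Set Implicit Arguments.
Unset Strict Implicit.
Unset Printing Implicit Defensive.

Import Order.TTheory GRing.Theory Num.Theory.
Import numFieldNormedType.Exports.

Local Open Scope classical_set_scope.
Local Open Scope ring_scope.

(** Why the theorem is true.

    Evaluating a Korovkin estimate at a point makes no sense in L^p, so the
    classical argument is run with a parameter. Let g >= 0 be Lipschitz. For
    every eps > 0 there is delta with
      |g(x) - g(y)| <= eps + delta |x - y|^2,
    and for a fixed y the right-hand side, as a function of x, is a
    combination with nonnegative coefficients c_j(y) of the test functions
    e_j = 1, pr_k, -pr_k, |.|^2: nonnegativity is what sublinearity can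
    handle, and this is why both signs of pr_k are among the test functions.
    A sublinear monotone A satisfies |A f - A g| <= A h as soon as
    |f - g| <= h (op_dist_le), so that, for every y,
      |A g - g(y) A 1| <= \sum_j c_j(y) A e_j   almost everywhere;
    here g(y) >= 0 is needed for A (g(y) 1) = g(y) A 1. The exceptional null
    set depends on y, but both sides are continuous in y: discarding the
    countably many null sets of the rational y, one may substitute y := x
    (korovkin_pointwise). Since \sum_j c_j(x) e_j(x) = eps, this reads
      |A g - g A 1| <= eps + \sum_j c_j (A e_j - e_j),
    and as g and the c_j are bounded on the compact support,
      |A g - g| <= eps + K |A 1 - 1| + \sum_j C_j |A e_j - e_j|,
    whence T_n g -> g in p-mean (korovkin_cvg).

    The passage to arbitrary f is by density. Bounded Lipschitz functions
    are dense in L^p (lipschitz_dense), the operators are M-Lipschitz for the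
    L^p norm (Lnrm_op_dist), and so the set of f with T_n f -> f is closed
    (cvg_op_closed). If f >= 0, taking the positive part of the approximants
    keeps them nonnegative. If the operators are translatable, a bounded
    Lipschitz g is made nonnegative by adding a constant K, and
    T_n (g + K 1) = T_n g + K T_n 1 takes the constant off again. *)

(** * The norm of L^p and dominated convergence *)

Section Lp_norm.
Context d (T : measurableType d) (R : realType).
Variables (mu : {finite_measure set T -> \bar R}) (p : R).
Variable p1 : (1 <= p%:E)%E.
Local Notation L := (LspaceType mu p1).
Implicit Types f g h u : L.

Let p_ge1 : 1 <= p. Proof. by rewrite -lee_fin. Qed.
Let p_gt0 : 0 < p. Proof. exact: lt_le_trans p_ge1. Qed.
Let p_ge0 : 0 <= p. Proof. exact: ltW. Qed.

Definition Lnrm f : R := fine (Lpnorm f).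

Lemma LpnormE f : Lpnorm f = (Lnrm f)%:E.
Proof.
rewrite fineK// ge0_fin_numE; first exact: Lebesgue_finite.
exact: Lnorm_ge0.
Qed.

Lemma Lnrm_ge0 f : 0 <= Lnrm f.
Proof. by rewrite -lee_fin -LpnormE Lnorm_ge0. Qed.

Lemma cvg_pmeanP (u : nat -> L) f :
  cvg_pmean u f <-> Lnrm (u n - f) @[n --> \oo] --> 0.
Proof.
rewrite /cvg_pmean; under eq_fun do rewrite LpnormE.
by split=> [/fine_cvgP[_ +]|h]; [|apply: cvg_EFin => //; exact: nearW].
Qed.

Lemma measurable_normr_powR (h : T -> R) : measurable_fun setT h ->
  measurable_fun setT (fun x => (`|h x| `^ p)%:E : \bar R).
Proof.
move=> mh; apply/measurable_EFinP.
by apply: (@measurableT_comp _ _ _ _ _ _ (@powR R ^~ p)) => //;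
  exact: measurableT_comp.
Qed.

Lemma Lnorm_le (f g : T -> R) : measurable_fun setT f -> measurable_fun setT g ->
  {ae mu, forall x, `|f x| <= `|g x|} ->
  ('N[mu]_p%:E[EFin \o f] <= 'N[mu]_p%:E[EFin \o g])%E.
Proof.
move=> mf mg fg; rewrite unlock; apply: gt0_ler_poweR => //.
- by rewrite invr_ge0.
- by rewrite in_itv/= leey andbT integral_ge0.
- by rewrite in_itv/= leey andbT integral_ge0.
- apply: ae_ge0_le_integral => //; try exact: measurable_normr_powR.
  + by move=> x _; rewrite lee_fin powR_ge0.
  + by move=> x _; rewrite lee_fin powR_ge0.
  + apply: filterS fg => x fgx _ /=.
    by rewrite lee_fin ge0_ler_powR ?nnegrE.
Qed.

Lemma Lnrm_le f g :
  {ae mu, forall x, `|f x : R| <= `|g x : R|} -> Lnrm f <= Lnrm g.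
Proof.
move=> fg; rewrite -lee_fin -!LpnormE; apply: Lnorm_le fg => //.
all: exact: Lspace_measurable.
Qed.

Lemma LspaceB_ae f g : {ae mu, forall x, (f - g) x = (f x : R) - (g x : R)}.
Proof.
apply: filterS2 (LspaceD_ae f (- g)) (LspaceN_ae g) => x.
by move=> -> ->.
Qed.


Lemma LnrmD f g : Lnrm (f + g) <= Lnrm f + Lnrm g.
Proof.
rewrite -lee_fin EFinD -!LpnormE.
have mf := Lspace_measurable f; have mg := Lspace_measurable g.
apply: le_trans (minkowski_EFin mu mf mg p_ge1).
apply: Lnorm_le; [exact: Lspace_measurable|exact: measurable_funD|].
by apply: filterS (LspaceD_ae f g) => x ->.
Qed.

Lemma LnrmZ (a : R) f : Lnrm (a *: f) = `|a| * Lnrm f.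
Proof.
apply: EFin_inj; rewrite EFinM -!LpnormE /Lpnorm -(LnormZ (Lrepr f)).
apply: ae_eq_Lnorm => //; first exact: Lspace_measurable.
  by apply: measurable_funM => //; exact: (Lspace_measurable f).
by apply: filterS (LspaceZ_ae a f) => x -> _.
Qed.

Lemma Lnrm0 : Lnrm 0 = 0.
Proof. by rewrite -(scale0r 0) LnrmZ normr0 mul0r. Qed.

Lemma LnrmN f : Lnrm (- f) = Lnrm f.
Proof. by rewrite -scaleN1r LnrmZ normrN1 mul1r. Qed.

Lemma Lnrm_eq0 f : Lnrm f = 0 -> f = 0.
Proof.
move=> f0; apply/Lspace_eqP.
have : Lpnorm f = 0%E by rewrite LpnormE f0.
have mf : measurable_fun setT (EFin \o (f : T -> R)).
  by apply/measurable_EFinP; exact: Lspace_measurable.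
move=> /(Lnorm_eq0_eq0 mf (lt_le_trans lte01 p1)).
apply: filterS2 (Lspace0_ae mu p1) => x /= f0x /(_ I) [] fx _.
by rewrite fx.
Qed.

(** Pointwise constructions (absolute value, positive part, indicators) leave
    the type of a.e. classes; this brings their result back, and the next
    lemma does so for functions dominated by an element of L^p. *)
Lemma Lspace_lift (h : T -> R) : h \in Lfun mu p%:E ->
  {u : L | {ae mu, forall x, u x = h x :> R}}.
Proof.
move=> Lh; exists (Lclass (Lfun_Sub p1 Lh)).
by apply: filterS (Lclass_ae (Lfun_Sub p1 Lh)) => x /(_ I).
Qed.

Lemma Lspace_lift_le (h : T -> R) f : measurable_fun setT h ->
  {ae mu, forall x, `|h x| <= `|f x : R|} ->
  {u : L | {ae mu, forall x, u x = h x :> R}}.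
Proof.
move=> mh hf; apply: Lspace_lift; apply/andP; split; rewrite inE//= /finite_norm.
apply: (@le_lt_trans _ _ (Lpnorm f)); last exact: Lebesgue_finite.
by apply: Lnorm_le => //; exact: Lspace_measurable.
Qed.

Lemma Lspace_lincomb_ae (J : finType) (a : J -> R) (F : J -> L) :
  {ae mu, forall x, (\sum_j a j *: F j) x = \sum_j a j * (F j x : R)}.
Proof.
rewrite /index_enum; elim: (Finite.enum J) => [|j s IH].
  by apply: filterS (Lspace0_ae mu p1) => x; rewrite !big_nil.
rewrite !big_cons.
apply: filterS3 IH (LspaceZ_ae (a j) (F j))
  (LspaceD_ae (a j *: F j) (\sum_(i <- s) a i *: F i)) => x e1 e2 ->.
by rewrite big_cons e1 e2.
Qed.

Lemma Lnrm_sum (J : finType) (F : J -> L) :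
  Lnrm (\sum_j F j) <= \sum_j Lnrm (F j).
Proof.
elim/big_ind2: _ => //; first by rewrite Lnrm0.
by move=> a f b g fa gb; rewrite (le_trans (LnrmD f g))// lerD.
Qed.

(** The p-th powers of |u_n - f| are dominated by those of 2h, so the dominated
    convergence theorem applies to them. *)
Lemma Lnrm_dominated_cvg (u : nat -> L) f h :
  {ae mu, forall x n, `|u n x : R| <= h x} ->
  {ae mu, forall x, (u n x : R) @[n --> \oo] --> (f x : R)} ->
  Lnrm (u n - f) @[n --> \oo] --> 0.
Proof.
move=> uh uf.
pose D n x : \bar R := (`|(u n x : R) - f x| `^ p)%:E.
pose H x : \bar R := ((2 `^ p) * (`|h x : R| `^ p))%:E.
have fh : {ae mu, forall x, `|f x : R| <= h x}.
  apply: filterS2 uh uf => x uhx ufx.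
  have nuf : `|u n x : R| @[n --> \oo] --> `|f x : R| by exact: cvg_norm.
  by apply: (cvgr_to_le nuf); apply: nearW => n; exact: uhx.
have mD n : measurable_fun setT (D n).
  apply: (@measurable_normr_powR (fun x => (u n x : R) - f x)).
  by apply: measurable_funB; exact: Lspace_measurable.
have iH : mu.-integrable setT H.
  rewrite (_ : H = fun x => ((2 `^ p)%:E * (`|h x : R| `^ p)%:E)%E).
    by apply: integrableZl => //; exact: Lfun_integrable (Lspace_Lfun h).
  by apply/funext => x; rewrite -EFinM.
have [_ _] : [/\ mu.-integrable setT (cst 0%E : T -> \bar R),
  [sequence (\int[mu]_x `|D n x - 0|)%E]_n @ \oo --> 0%E &
  [sequence (\int[mu]_x D n x)%E]_n @ \oo --> (\int[mu]_x cst 0 x)%E].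
  apply: (dominated_convergence _ mD _ _ iH) => //.
  - apply: filterS uf => x ufx _; apply: cvg_EFin; first exact: nearW.
    have -> : fine \o D ^~ x = fun n => `|(u n x : R) - f x| `^ p by [].
    have n0 : `|(u n x : R) - f x| @[n --> \oo] --> 0.
      by apply/norm_cvg0P; apply/subr_cvg0.
    apply/cvgr0Pnorm_le => e e0.
    (* z |-> z ^ p is continuous at 0: take the p-th root of the precision. *)
    have e'0 : 0 < e `^ p^-1 by rewrite powR_gt0.
    move/cvgr0Pnorm_le : n0 => /(_ _ e'0); apply: filterS => n.
    rewrite normr_id => ?; rewrite (ger0_norm (powR_ge0 _ _)).
    have -> : e = (e `^ p^-1) `^ p.
      by rewrite -powRrM mulVf ?gt_eqF// powRr1// ltW.
    by rewrite ge0_ler_powR ?nnegrE ?powR_ge0.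
  - apply: filterS2 uh fh => x uhx fhx n _.
    rewrite /D /H /= lee_fin ger0_norm ?powR_ge0// -powRM//.
    rewrite ge0_ler_powR ?nnegrE ?mulr_ge0//.
    apply: le_trans (ler_normB _ _) _.
    rewrite [`|h x|]ger0_norm ?(le_trans _ fhx)//.
    by rewrite mulr2n mulrDl mul1r lerD.
rewrite integral0 => D0.
have DE n : (\int[mu]_x D n x)%E = (Lnrm (u n - f) `^ p)%:E.
  rewrite -poweR_EFin -LpnormE powR_Lnorm ?gt_eqF//.
  apply: ae_eq_integral => //.
    by apply: measurable_normr_powR; exact: Lspace_measurable.
  by apply: filterS (LspaceB_ae (u n) f) => x e _; rewrite /= e.
have {}D0 : Lnrm (u n - f) `^ p @[n --> \oo] --> 0.
  move: D0; under eq_fun do rewrite DE.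
  by move=> /fine_cvgP[].
apply/cvgr0Pnorm_le => e e0.
have e'0 : 0 < e `^ p by rewrite powR_gt0.
move/cvgr0Pnorm_le : D0 => /(_ _ e'0); apply: filterS => n.
rewrite !ger0_norm ?powR_ge0 ?Lnrm_ge0// => h1.
rewrite leNgt; apply/negP => h2; move: h1; rewrite leNgt => /negP; apply.
by rewrite gt0_ltr_powR// ?nnegrE ?Lnrm_ge0 // ltW.
Qed.

End Lp_norm.

(** * Bounded Lipschitz functions *)

Section bounded_lipschitz.
Context (R : realType) (V : normedModType R).
Implicit Types g h : V -> R.

Definition bounded_lipschitz g := exists K : R,
  (forall x, `|g x| <= K) /\ (forall x y, `|g x - g y| <= K * `|x - y|).

Lemma bounded_lipschitz_continuous g : bounded_lipschitz g -> continuous g.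
Proof.
move=> [K [gK gL]] x; apply/cvgrPdist_lt => e e0.
have K0 : 0 <= K by apply: le_trans (gK x).
have K1 : 0 < K + 1 by rewrite ltr_wpDl.
near=> y; apply: le_lt_trans (gL _ _) _.
apply: (@le_lt_trans _ _ ((K + 1) * `|x - y|)).
  by rewrite ler_wpM2r// lerDl.
rewrite mulrC -ltr_pdivlMr//; near: y.
by apply: cvgr_dist_lt; [exact: cvg_id|rewrite divr_gt0].
Unshelve. all: by end_near. Qed.

Lemma bounded_lipschitz_cst (c : R) : bounded_lipschitz (cst c).
Proof. by exists `|c|; split=> // x y; rewrite subrr normr0 mulr_ge0. Qed.

Lemma bounded_lipschitzD g h : bounded_lipschitz g -> bounded_lipschitz h ->
  bounded_lipschitz (fun x => g x + h x).
Proof.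
move=> [K [gK gL]] [K' [hK hL]]; exists (K + K'); split=> [x|x y].
  by apply: le_trans (ler_normD _ _) _; exact: lerD.
rewrite opprD addrACA mulrDl.
by apply: le_trans (ler_normD _ _) _; exact: lerD.
Qed.

Lemma bounded_lipschitzZ (a : R) g : bounded_lipschitz g ->
  bounded_lipschitz (fun x => a * g x).
Proof.
move=> [K [gK gL]]; exists (`|a| * K); split=> [x|x y].
  by rewrite normrM ler_wpM2l.
by rewrite -mulrBr normrM -mulrA ler_wpM2l.
Qed.

Lemma bounded_lipschitz_max0 g : bounded_lipschitz g ->
  bounded_lipschitz (fun x => Num.max (g x) 0).
Proof.
move=> [K [gK gL]]; exists K; split=> [x|x y].
  by apply: le_trans (gK x); case: (leP (g x) 0) => // _; rewrite normr0.
apply: le_trans (gL x y).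
case: (leP (g x) 0) => gx; case: (leP (g y) 0) => gy //.
- by rewrite subrr normr0.
- rewrite !ler_normr; apply/orP; right.
  by rewrite sub0r normrN gtr0_norm// opprB lerBrDr gerDl.
- by rewrite ler_normr; apply/orP; left; rewrite subr0 gtr0_norm// lerBrDr gerDl.
Qed.

Variable U : set V.

(** The inf-convolution of the indicator of [U] with [n%:R * `|.|]: the largest
    n-Lipschitz minorant of that indicator. No distance to the complement of
    [U] occurs, so that the case of an empty complement is not special. *)
Definition lipschitz_indic (n : nat) (x : V) : R :=
  inf (range (fun y => \1_U y + n%:R * `|x - y|)).

Let lb0 n x : lbound (range (fun y => \1_U y + n%:R * `|x - y|)) (0 : R).
Proof. by move=> _ [y _ <-]; rewrite addr_ge0 ?mulr_ge0// indicE. Qed.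

Let hlb n x : has_lbound (range (fun y => \1_U y + n%:R * `|x - y| : R)).
Proof. by exists 0; exact: lb0. Qed.

Lemma lipschitz_indic_ge0 n x : 0 <= lipschitz_indic n x.
Proof. by apply: lb_le_inf; [exists (\1_U x + n%:R * `|x - x|), x|exact: lb0]. Qed.

Lemma lipschitz_indic_le n x : lipschitz_indic n x <= \1_U x.
Proof.
apply: ge_inf; first exact: hlb.
by exists x => //; rewrite subrr normr0 mulr0 addr0.
Qed.

Lemma lipschitz_indic_bl n : bounded_lipschitz (lipschitz_indic n).
Proof.
exists n.+1%:R; split=> [x|x y].
  rewrite ger0_norm ?lipschitz_indic_ge0//.
  apply: le_trans (lipschitz_indic_le n x) _; rewrite indicE.
  by case: (_ \in _); rewrite ?ler1n ?ler0n.
have H a b : lipschitz_indic n a - lipschitz_indic n b <= n.+1%:R * `|a - b|.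
  rewrite lerBlDr -lerBlDl; apply: lb_le_inf.
    by exists (\1_U b + n%:R * `|b - b|), b.
  move=> _ [z _ <-]; rewrite lerBlDl.
  apply: (@le_trans _ _ (\1_U z + n%:R * `|a - z|)).
    by apply: ge_inf; [exact: hlb|exists z].
  rewrite addrCA lerD2l.
  apply: (@le_trans _ _ (n%:R * (`|a - b| + `|b - z|))).
    by rewrite ler_wpM2l// ler_distD.
  by rewrite mulrDr lerD2r ler_wpM2r// ler_nat.
by rewrite ler_norml H andbT lerNl opprB distrC H.
Qed.

(** At a point of [U] the minorant equals 1 once [n] exceeds the inverse of the
    radius of a ball around it contained in [U]. *)
Lemma lipschitz_indic_cvg x : open U ->
  lipschitz_indic n x @[n --> \oo] --> (\1_U x : R).
Proof.
move=> oU; have [xU|xU] := boolP (x \in U); last first.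
  apply: cvg_near_cst; apply: nearW => n; apply/eqP.
  by rewrite eq_le lipschitz_indic_le indicE (negbTE xU) lipschitz_indic_ge0.
have /nbhs_ballP[r /= r0 rU] : nbhs x U.
  by apply: open_nbhs_nbhs; split=> //; exact: set_mem.
apply: cvg_near_cst; near=> n; apply/eqP.
rewrite eq_le lipschitz_indic_le indicE xU /=; apply: lb_le_inf.
  by exists (\1_U x + n%:R * `|x - x|), x.
move=> _ [y _ <-]; rewrite indicE.
have [yU|yU] := boolP (y \in U); first by rewrite lerDl mulr_ge0.
rewrite add0r; have : r <= `|x - y|.
  rewrite leNgt; apply/negP => xy; move/negP: yU; apply; rewrite inE.
  by apply: rU; rewrite -ball_normE.
move=> /(ler_wpM2l (ler0n R n)); apply: le_trans.
rewrite -ler_pdivrMr// div1r; near: n; exact: nbhs_infty_ger.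
Unshelve. all: by end_near. Qed.

End bounded_lipschitz.

(** * Density of bounded Lipschitz functions in L^p *)

Import HBNNSimple.

Section density.
Context (R : realType) (N : nat).
Local Notation E := (borel_rV R N).
Variables (mu : {finite_measure set E -> \bar R}) (p : R).
Variable p1 : (1 <= p%:E)%E.
Local Notation L := (LspaceType mu p1).
Implicit Types f h u : L.

Definition lipschitz_approx f := forall e : R, 0 < e ->
  exists (g : 'rV[R]_N -> R) u, [/\ bounded_lipschitz (g : 'rV[R]_N -> R),
    {ae mu, forall x, u x = g x :> R} & Lnrm (f - u) < e].

Lemma Lspace_lift_bl (g : 'rV[R]_N -> R) : bounded_lipschitz g ->
  {u : L | {ae mu, forall x, u x = g x :> R}}.
Proof.
move=> bg; have [K [gK _]] := cid bg.
have [c cK] := Lspace_lift p1 (Lfun_cst mu K p).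
apply: (@Lspace_lift_le _ _ _ mu p p1 g c).
  by apply: continuous_borel_rV; exact: bounded_lipschitz_continuous.
apply: filterS cK => x ->.
by rewrite (le_trans (gK x))// ler_norm.
Qed.

Lemma lipschitz_approxD f f' :
  lipschitz_approx f -> lipschitz_approx f' -> lipschitz_approx (f + f').
Proof.
move=> af af' e e0; have e20 : 0 < e / 2 by rewrite divr_gt0.
have [g [u [bg ug ue]]] := af _ e20; have [g' [u' [bg' ug' ue']]] := af' _ e20.
exists (fun x => g x + g' x), (u + u'); split.
- exact: bounded_lipschitzD.
- apply: filterS3 ug ug' (LspaceD_ae u u') => x.
  by move=> -> -> ->.
- rewrite opprD addrACA (splitr e).
  by apply: le_lt_trans (LnrmD _ _) _; exact: ltrD.
Qed.

Lemma lipschitz_approxZ (a : R) f : lipschitz_approx f -> lipschitz_approx (a *: f).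
Proof.
move=> af e e0; have a1 : 0 < `|a| + 1 by rewrite ltr_wpDl.
have [g [u [bg ug ue]]] := af (e / (`|a| + 1)) (divr_gt0 e0 a1).
exists (fun x => a * g x), (a *: u); split.
- exact: bounded_lipschitzZ.
- by apply: filterS2 ug (LspaceZ_ae a u) => x -> ->.
- rewrite -scalerBr LnrmZ.
  apply: (@le_lt_trans _ _ ((`|a| + 1) * Lnrm (f - u))).
    by rewrite ler_wpM2r ?Lnrm_ge0// lerDl.
  by rewrite mulrC -ltr_pdivlMr.
Qed.

Lemma lipschitz_approx_bl (g : 'rV[R]_N -> R) f : bounded_lipschitz g ->
  {ae mu, forall x, f x = g x :> R} -> lipschitz_approx f.
Proof. by move=> bg fg e e0; exists g, f; rewrite subrr Lnrm0. Qed.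

Lemma lipschitz_approx_sum (J : Type) (s : seq J) (F : J -> L) :
  (forall j, lipschitz_approx (F j)) -> lipschitz_approx (\sum_(j <- s) F j).
Proof.
move=> aF; elim/big_ind: _ => //; last exact: lipschitz_approxD.
apply: (@lipschitz_approx_bl (cst 0)); first exact: bounded_lipschitz_cst.
exact: Lspace0_ae.
Qed.

Lemma lipschitz_approx_dominated (v : nat -> L) f h :
  (forall n, lipschitz_approx (v n)) ->
  {ae mu, forall x n, `|v n x : R| <= h x} ->
  {ae mu, forall x, (v n x : R) @[n --> \oo] --> (f x : R)} ->
  lipschitz_approx f.
Proof.
move=> av vh vf e e0; have e20 : 0 < e / 2 by rewrite divr_gt0.
have /cvgr0Pnorm_lt /(_ _ e20) [n _ /(_ _ (leqnn n)) /=] := Lnrm_dominated_cvg vh vf.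
rewrite ger0_norm ?Lnrm_ge0// => vnf.
have [g [u [bg ug ue]]] := av n _ e20.
exists g, u; split=> //; rewrite -(subrK (v n) f) -addrA (splitr e).
by apply: le_lt_trans (LnrmD _ _) _; rewrite -LnrmN opprB ltrD.
Qed.

(** The indicator of an open set is the bounded limit of its Lipschitz
    minorants. *)
Lemma lipschitz_approx_open (U : set 'rV[R]_N) f : open U ->
  {ae mu, forall x, f x = \1_U x :> R} -> lipschitz_approx f.
Proof.
move=> oU fU.
pose v n := sval (Lspace_lift_bl (lipschitz_indic_bl U n)).
have vE : {ae mu, forall x n, v n x = lipschitz_indic U n x :> R}.
  by apply/ae_foralln => n; rewrite /v; case: (Lspace_lift_bl _).
apply: (@lipschitz_approx_dominated v f f).
- move=> n; apply: lipschitz_approx_bl (lipschitz_indic_bl U n) _.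
  by apply: filterS vE.
- apply: filterS2 vE fU => x vx -> n.
  by rewrite vx ger0_norm ?lipschitz_indic_ge0 ?lipschitz_indic_le.
- apply: filterS2 vE fU => x vx ->; under eq_fun do rewrite vx.
  exact: lipschitz_indic_cvg.
Qed.

(** The sets of the lambda-system below. Measurability is part of the
    definition because the closure properties need a class in L^p that
    represents the indicator; without it the second condition could hold
    vacuously. *)
Definition approx_indic (A : set E) := measurable A /\
  forall f, {ae mu, forall x, f x = \1_A x :> R} -> lipschitz_approx f.

Lemma Lspace_lift_indic (A : set E) : measurable A ->
  {u : L | {ae mu, forall x, u x = \1_A x :> R}}.
Proof.
move=> mA.
have [c c1] := Lspace_lift p1 (Lfun_cst mu 1 p).
apply: (@Lspace_lift_le _ _ _ mu p p1 \1_A c); first exact: measurable_indic.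
apply: filterS c1 => x ->.
by rewrite indicE; case: (_ \in _); rewrite ?normr0 ?normr1.
Qed.

(** Open sets form a pi-system generating the Borel sets, so it is enough that
    [approx_indic] is a lambda-system: differences correspond to subtraction
    and increasing unions to dominated limits. *)
Lemma approx_indic_measurable (A : set E) : measurable A -> approx_indic A.
Proof.
have : <<s setT, @open 'rV[R]_N >> `<=` approx_indic; last exact.
apply: lambda_system_subset => //; first by move=> B C; exact: openI.
  split=> //.
  - split=> // f fT; apply: (@lipschitz_approx_bl (cst 1)).
      exact: bounded_lipschitz_cst.
    by apply: filterS fT => x ->; rewrite indicE in_setT.
  - move=> B C CB [mB aB] [mC aC]; split; first exact: measurableD.
    move=> f fBC.
    have [u uB] := Lspace_lift_indic mB; have [v vC] := Lspace_lift_indic mC.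
    rewrite (_ : f = u + (-1) *: v).
      by apply: lipschitz_approxD; [exact: aB|apply: lipschitz_approxZ; exact: aC].
    apply/Lspace_eqP; near=> x => _.
    rewrite (near (LspaceD_ae u ((-1) *: v)) x)//.
    have -> : ((-1) *: v) x = -1 * v x :> R by near: x; exact: LspaceZ_ae.
    have -> : v x = \1_C x :> R by near: x.
    have -> : u x = \1_B x :> R by near: x.
    have -> : f x = \1_(B `\` C) x :> R by near: x.
    rewrite !indicE in_setD mulN1r.
    have [xC|xC] := boolP (x \in C); last by rewrite andbT subr0.
    by rewrite (mem_set (CB _ (set_mem xC))) subrr.
  - move=> F ndF aF; split; first by apply: bigcup_measurable => n _; case: (aF n).
    move=> f fF; pose v n := sval (Lspace_lift_indic (aF n).1).
    have vE : {ae mu, forall x n, v n x = \1_(F n) x :> R}.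
      by apply/ae_foralln => n; rewrite /v; case: (Lspace_lift_indic _).
    apply: (@lipschitz_approx_dominated v f f).
    + by move=> n; apply: (aF n).2; apply: filterS vE.
    + apply: filterS2 vE fF => x vx -> n; rewrite vx !indicE.
      have [xF|xF] := boolP (x \in F n); last by rewrite normr0.
      by rewrite normr1 mem_set//; exists n => //; exact: set_mem.
    + apply: filterS2 vE fF => x vx ->; under eq_fun do rewrite vx.
      rewrite !indicE; have [xF|xF] := boolP (x \in _); apply: cvg_near_cst.
        have [m _ Fmx] := set_mem xF; exists m => // n /= mn; apply/eqP.
        by rewrite indicE mem_set//; exact: (subsetPset _ _ (ndF _ _ mn)).
      apply: nearW => n; apply/eqP; rewrite indicE memNset// => Fnx.
      by move/negP: xF; apply; rewrite inE; exists n.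
move=> U oU; split; first exact: open_borel_rV.
by move=> f; exact: lipschitz_approx_open.
Unshelve. all: by end_near. Qed.

Lemma lipschitz_approx_nnsfun (h : {nnsfun E >-> R}) f :
  {ae mu, forall x, f x = h x :> R} -> lipschitz_approx f.
Proof.
move=> fh.
have mh (y : R) : measurable (h @^-1` [set y]) by exact: measurable_funPTI.
pose s : seq R := finmap.enum_fset (fset_set (range h)).
pose u y := sval (Lspace_lift_indic (mh y)).
have uE y : {ae mu, forall x, u y x = \1_(h @^-1` [set y]) x :> R}.
  by rewrite /u; case: (Lspace_lift_indic _).
have -> : f = \sum_(i < size s) s`_i *: u s`_i.
  apply/Lspace_eqP.
  have uA : {ae mu, forall x (i : nat), u s`_i x = \1_(h @^-1` [set s`_i]) x :> R}.
    by apply/ae_foralln => i; exact: uE.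
  apply: filterS3 fh uA (Lspace_lincomb_ae (fun i : 'I_(size s) => s`_i)
    (fun i => u s`_i)) => x -> ux -> _.
  by rewrite fimfunEord; apply: eq_bigr => i _; rewrite ux.
apply: lipschitz_approx_sum => i; apply: lipschitz_approxZ.
exact: (approx_indic_measurable (mh _)).2.
Qed.

Lemma lipschitz_approx_ge0 f : Lle 0 f -> lipschitz_approx f.
Proof.
move=> f0; pose f' x : R := Num.max (f x : R) 0.
have mf' : measurable_fun setT (EFin \o f').
  apply/measurable_EFinP; apply: measurable_maxr; last exact: measurable_cst.
  exact: Lspace_measurable.
have {}f0 : {ae mu, forall x, f x = f' x :> R}.
  by apply: filterS2 f0 (Lspace0_ae mu p1) => x /[swap] -> fx; rewrite /f' max_l.
have f'0 x : 0 <= f' x by rewrite /f' le_max lexx orbT.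
pose h n := nnsfun_approx measurableT mf' n.
have hf n x : 0 <= h n x <= f' x.
  apply/andP; split; first exact: fun_ge0.
  have : forall y, setT y -> (0 <= (EFin \o f') y)%E by move=> y _; rewrite lee_fin.
  rewrite /h nnsfun_approxE => fE.
  by have := le_approx n fE (I : setT x); rewrite lee_fin.
have hcvg x : h n x @[n --> \oo] --> f' x.
  have : EFin \o h^~ x @ \oo --> (EFin \o f') x.
    by apply: cvg_nnsfun_approx => // y _; rewrite lee_fin.
  by move=> /fine_cvgP[].
have vex n : {u : L | {ae mu, forall x, u x = h n x :> R}}.
  apply: (@Lspace_lift_le _ _ _ mu p p1 _ f) => //.
  apply: filterS f0 => x ->; have /andP[h0 hf'] := hf n x.
  by rewrite !ger0_norm.
pose v n := sval (vex n).
have vE : {ae mu, forall x n, v n x = h n x :> R}.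
  by apply/ae_foralln => n; rewrite /v; case: (vex n).
apply: (@lipschitz_approx_dominated v f f).
- by move=> n; apply: (@lipschitz_approx_nnsfun (h n)); apply: filterS vE.
- apply: filterS2 vE f0 => x vx -> n; have /andP[h0 hf'] := hf n x.
  by rewrite vx ger0_norm.
- apply: filterS2 vE f0 => x vx ->; under eq_fun do rewrite vx.
  exact: hcvg.
Qed.

(** The approximable classes form a vector space closed under dominated limits.
    It contains the indicators of Borel sets, hence the simple functions, hence
    the nonnegative classes, and every class is a difference of two of these. *)
Theorem lipschitz_dense f : lipschitz_approx f.
Proof.
have pos (g : L) : {u : L | {ae mu, forall x, u x = Num.max (g x : R) 0 :> R}}.
  apply: (@Lspace_lift_le _ _ _ mu p p1 _ g).
    apply: measurable_maxr; last exact: measurable_cst.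
    exact: Lspace_measurable.
  apply: nearW => x; case: (leP (g x : R) 0) => // _; by rewrite normr0.
have [u uE] := pos f; have [v vE] := pos (- f).
have apos (w g : L) : {ae mu, forall x, w x = Num.max (g x : R) 0 :> R} ->
    lipschitz_approx w.
  move=> wE; apply: lipschitz_approx_ge0.
  by apply: filterS2 wE (Lspace0_ae mu p1) => x -> ->; rewrite le_max lexx orbT.
rewrite (_ : f = u + (-1) *: v).
  by apply: lipschitz_approxD; [exact: apos uE|apply: lipschitz_approxZ; exact: apos vE].
apply/Lspace_eqP; near=> x => _.
rewrite (near (LspaceD_ae u ((-1) *: v)) x)//.
have -> : ((-1) *: v) x = -1 * v x :> R by near: x; exact: LspaceZ_ae.
have -> : u x = Num.max (f x : R) 0 by near: x.
have -> : v x = Num.max ((- f) x : R) 0 by near: x.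
have -> : (- f) x = - (f x : R) by near: x; exact: LspaceN_ae.
case: (leP (f x : R) 0) => fx.
  by rewrite max_l ?oppr_ge0// mulN1r opprK add0r.
by rewrite max_r ?mulr0 ?addr0// oppr_le0 ltW.
Unshelve. all: by end_near. Qed.

End density.

(** * Sublinear monotone operators on L^p *)

Section sublinear_monotone.
Context d (T : measurableType d) (R : realType).
Variables (mu : {finite_measure set T -> \bar R}) (p : R).
Variable p1 : (1 <= p%:E)%E.
Local Notation L := (LspaceType mu p1).
Implicit Types f g h u : L.

Lemma Lspace_abs f : {u : L | {ae mu, forall x, u x = `|f x : R| :> R}}.
Proof.
apply: (@Lspace_lift_le _ _ _ mu p p1 _ f).
  by apply: measurableT_comp => //; exact: Lspace_measurable.
by apply: nearW => x; rewrite normr_id.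
Qed.

Definition Labs f : L := sval (Lspace_abs f).

Lemma Labs_ae f : {ae mu, forall x, Labs f x = `|f x : R| :> R}.
Proof. by rewrite /Labs; case: (Lspace_abs f). Qed.

Lemma Lnrm_abs f : Lnrm (Labs f) = Lnrm f.
Proof.
by apply/eqP; rewrite eq_le; apply/andP; split; apply: Lnrm_le;
  apply: filterS (Labs_ae f) => x ->; rewrite normr_id.
Qed.

Section one_operator.
Variable A : L -> L.
Hypotheses (A_sublinear : op_sublinear A) (A_monotone : op_monotone A).

Lemma op_sublinear0 : A 0 = 0.
Proof. by have := A_sublinear.2 0 0 (lexx 0); rewrite !scale0r. Qed.

Lemma op_sublinear_sum (J : finType) (F : J -> L) :
  Lle (A (\sum_j F j)) (\sum_j A (F j)).
Proof.
elim/big_ind2: _ => [||j _]; [by rewrite op_sublinear0; exact: nearW| |exact: nearW].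
move=> a f b g fa gb.
move: (A_sublinear.1 f g) (LspaceD_ae (A f) (A g)) (LspaceD_ae a b).
rewrite /Lle in fa gb * => Afg AD ab.
near=> x; rewrite (near ab x)//; apply: (le_trans (near Afg x _)) => //.
rewrite (near AD x)//; by apply: lerD; [apply: (near fa x)|apply: (near gb x)].
Unshelve. all: by end_near. Qed.

Let op_dist_le1 f g h : {ae mu, forall x, `|(f x : R) - g x| <= h x} ->
  {ae mu, forall x, (A f x : R) - A g x <= A h x}.
Proof.
move=> fgh.
have /A_monotone Afgh : Lle (f - g) h.
  by apply: filterS2 fgh (LspaceB_ae f g) => x + ->; rewrite ler_norml => /andP[].
have := A_sublinear.1 (f - g) g; rewrite subrK => Afg.
apply: filterS3 Afgh Afg (LspaceD_ae (A (f - g)) (A g)) => x Ah + e.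
by rewrite e => Af; rewrite lerBlDr (le_trans Af)// lerD2r.
Qed.

(** From f <= g + (f - g) one gets A f <= A g + A (f - g) <= A g + A h, and
    symmetrically. This replaces linearity everywhere below. *)
Lemma op_dist_le f g h : {ae mu, forall x, `|(f x : R) - g x| <= h x} ->
  {ae mu, forall x, `|(A f x : R) - A g x| <= A h x}.
Proof.
move=> fgh.
have gfh : {ae mu, forall x, `|(g x : R) - f x| <= h x}.
  by apply: filterS fgh => x; rewrite distrC.
apply: filterS2 (op_dist_le1 fgh) (op_dist_le1 gfh) => x fg gf.
by rewrite ler_norml fg andbT lerNl opprB.
Qed.

Variable M : R.
Hypothesis A_bounded : (opnorm A <= M%:E)%E.

Lemma Lnrm_op f : Lnrm (A f) <= M * Lnrm f.
Proof.
have [/Lnrm_eq0 ->|f0] := eqVneq (Lnrm f) 0.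
  by rewrite op_sublinear0 Lnrm0 mulr0.
have {}f0 : 0 < Lnrm f by rewrite lt_def f0 Lnrm_ge0.
have fE : f = Lnrm f *: ((Lnrm f)^-1 *: f) by rewrite scalerA mulfV ?gt_eqF// scale1r.
rewrite {1}fE A_sublinear.2 ?Lnrm_ge0// LnrmZ ger0_norm ?Lnrm_ge0// mulrC.
rewrite ler_wpM2r ?Lnrm_ge0// -lee_fin -LpnormE (le_trans _ A_bounded)//.
apply: ereal_sup_ubound; exists ((Lnrm f)^-1 *: f) => //=.
by rewrite LpnormE LnrmZ ger0_norm ?invr_ge0 ?Lnrm_ge0// mulVf// gt_eqF.
Qed.

(** Boundedness on the unit ball gives Lipschitz continuity through
    [op_dist_le] with h = |f - g|. *)
Lemma Lnrm_op_dist f g : Lnrm (A f - A g) <= M * Lnrm (f - g).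
Proof.
rewrite -[Lnrm (f - g)]Lnrm_abs; apply: le_trans (Lnrm_op _).
have /op_dist_le fg : {ae mu, forall x, `|(f x : R) - g x| <= Labs (f - g) x}.
  by apply: filterS2 (Labs_ae (f - g)) (LspaceB_ae f g) => x -> ->.
apply: Lnrm_le; apply: filterS2 fg (LspaceB_ae (A f) (A g)) => x fgx ->.
exact: le_trans (ler_norm _).
Qed.

End one_operator.

Lemma cvg_op_closed (A : nat -> L -> L) (M : R) f :
  (forall n, op_sublinear (A n)) -> (forall n, op_monotone (A n)) ->
  (forall n, opnorm (A n) <= M%:E)%E ->
  (forall e : R, 0 < e ->
    exists2 u, Lnrm (f - u) < e & cvg_pmean (fun n => A n u) u) ->
  cvg_pmean (fun n => A n f) f.
Proof.
move=> As Am AM fu; apply/cvg_pmeanP/cvgr0Pnorm_le => e e0.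
have M1 : 0 < `|M| + 1 by rewrite ltr_wpDl.
have e20 : 0 < e / 2 by rewrite divr_gt0.
have [u ufe /cvg_pmeanP/cvgr0Pnorm_le/(_ _ e20)] := fu _ (divr_gt0 e20 M1).
apply: filterS => n; rewrite !ger0_norm ?Lnrm_ge0// => Au.
have -> : A n f - f = (A n f - A n u) + (A n u - u) - (f - u).
  by rewrite opprB !addrA !subrK.
apply: le_trans (LnrmD _ _) _; rewrite LnrmN.
apply: le_trans (lerD (LnrmD _ _) (lexx _)) _.
rewrite addrAC (splitr e) lerD//.
apply: (@le_trans _ _ ((`|M| + 1) * Lnrm (f - u))).
  rewrite mulrDl mul1r lerD2r (le_trans (Lnrm_op_dist (As n) (Am n) (AM n) _ _))//.
  by rewrite ler_wpM2r ?Lnrm_ge0// ler_norm.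
by rewrite mulrC -ler_pdivlMr// ltW.
Qed.

End sublinear_monotone.

(** * Korovkin estimates *)

Section dense_parameters.
Context (R : realType) (N : nat).

Lemma rational_rV_near (y : 'rV[R]_N) (e : R) : 0 < e ->
  exists q : 'rV[rat]_N, `|y - map_mx ratr q| < e.
Proof.
move=> e0.
have qy (i : 'I_N) : {q : rat | `|y ord0 i - ratr q| < e}.
  apply: cid; have : y ord0 i < y ord0 i + e by rewrite ltrDl.
  move=> /rat_in_itvoo[q]; rewrite in_itv/= => /andP[yq qy]; exists q.
  by rewrite distrC ger0_norm ?subr_ge0 ?ltW// ltrBlDl.
exists (\row_i sval (qy i)).
have : ball y e (map_mx ratr (\row_i sval (qy i))).
  by split=> // i j; rewrite ord1 !mxE; exact: svalP (qy j).
by rewrite -ball_normE.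
Qed.

Lemma ae_and d (T : measurableType d) (mu : {measure set T -> \bar R})
    (P Q : T -> Prop) : {ae mu, forall x, P x} -> {ae mu, forall x, Q x} ->
  {ae mu, forall x, P x /\ Q x}.
Proof. exact: filterS2. Qed.

(** The null set is allowed to depend on the parameter: by continuity only the
    countably many rational parameters matter. *)
Lemma ae_forall_continuous d (T : measurableType d)
    (mu : {measure set T -> \bar R}) (F : 'rV[R]_N -> T -> R) :
  (forall x, continuous (F^~ x)) ->
  (forall y, {ae mu, forall x, 0 <= F y x}) ->
  {ae mu, forall x, forall y, 0 <= F y x}.
Proof.
move=> cF F0.
pose P n x := if (unpickle n : option 'rV[rat]_N) is Some q
  then 0 <= F (map_mx ratr q) x else true.
have : {ae mu, forall x n, P n x}.
  by apply/ae_foralln => n; rewrite /P; case: unpickle => [q|]; [exact: F0|exact: nearW].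
apply: filterS => x Px y; rewrite leNgt; apply/negP => Fy.
have /cvgrPdist_lt /(_ _ (_ : 0 < - F y x)) := cF x y.
rewrite oppr_gt0 => /(_ Fy) /nbhs_ballP[e /= e0 eF].
have [q yq] := rational_rV_near y e0.
have := Px (pickle q); rewrite /P pickleK => Fq.
have := eF (map_mx ratr q); rewrite -ball_normE => /(_ yq) /=.
rewrite ltr_norml => /andP[+ _]; rewrite opprK.
by rewrite ltrDl oppr_gt0 ltNge Fq.
Qed.

End dense_parameters.

Section korovkin.
Context (R : realType) (N : nat).
Local Notation E := (borel_rV R N).
Variables (mu : {finite_measure set E -> \bar R}) (p : R).
Variable p1 : (1 <= p%:E)%E.
Local Notation L := (LspaceType mu p1).
Implicit Types f G u : L.

Lemma Lone_ae : {ae mu, forall x, Lone mu p1 x = 1 :> R}.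
Proof. by apply: filterS (Lclass_ae (Lfun_Sub p1 (Lfun_cst mu 1 p))) => x /(_ I). Qed.

(** For each fixed y this is [op_dist_le] applied to G and the constant g y;
    what remains is to let the parameter y be the point x itself, and this is
    [ae_forall_continuous]. The coefficients must be nonnegative for A to be
    taken inside the sum. *)
Lemma korovkin_pointwise (A : L -> L) (J : finType) (e : J -> L)
    (c : J -> 'rV[R]_N -> R) (g : 'rV[R]_N -> R) G :
  op_sublinear A -> op_monotone A ->
  (forall j, continuous (c j)) -> (forall j y, 0 <= c j y) ->
  continuous g -> (forall y, 0 <= g y) ->
  (forall y, {ae mu, forall x, `|(G x : R) - g y| <= \sum_j c j y * e j x}) ->
  {ae mu, forall x, `|(A G x : R) - g x * A (Lone mu p1) x| <=
                    \sum_j c j x * A (e j) x}.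
Proof.
move=> As Am cc c0 cg g0 Gc.
pose F y x : R := \sum_j c j y * A (e j) x - `|(A G x : R) - g y * A (Lone mu p1) x|.
have cF x : continuous (F^~ x).
  have cs : continuous (fun y => \sum_j c j y * (A (e j) x : R)).
    apply: continuous_big => [|j _ y]; first exact: add_continuous.
    exact: continuousM (cc j y) (@cst_continuous _ _ _ _).
  have cn : continuous (fun y => `|(A G x : R) - g y * A (Lone mu p1) x|).
    have cf : continuous (fun y => (A G x : R) - g y * A (Lone mu p1) x).
      move=> y.
      have cgA := continuousM (cg y) (@cst_continuous _ _ (A (Lone mu p1) x : R) y).
      exact: continuousB (@cst_continuous _ _ _ _) cgA.
    by move=> y; exact: continuous_comp (cf y) (@norm_continuous _ R _).
  by move=> y; exact: continuousB (cs y) (cn y).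
have F0 y : {ae mu, forall x, 0 <= F y x}.
  pose h : L := \sum_j c j y *: e j.
  have Gh : {ae mu, forall x, `|(G x : R) - (g y *: Lone mu p1) x| <= h x}.
    apply: filterS2 (ae_and Lone_ae (LspaceZ_ae (g y) (Lone mu p1)))
      (ae_and (Gc y) (Lspace_lincomb_ae (c^~ y) e)) => x [one1 ->] [+ ->].
    by rewrite one1 mulr1.
  have := op_dist_le As Am Gh; rewrite As.2// => AGh.
  have Ah : {ae mu, forall x, (A h x : R) <= \sum_j c j y * (A (e j) x : R)}.
    have AE : \sum_j A (c j y *: e j) = \sum_j c j y *: A (e j).
      by apply: eq_bigr => j _; rewrite As.2.
    have := op_sublinear_sum As (fun j => c j y *: e j); rewrite AE => Ah.
    by apply: filterS2 Ah (Lspace_lincomb_ae (c^~ y) (A \o e)) => x + <-.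
  apply: filterS3 AGh Ah (LspaceZ_ae (g y) (A (Lone mu p1))) => x + hx e1.
  by rewrite e1 subr_ge0 => /le_trans; exact.
have := ae_forall_continuous cF F0; apply: filterS => x /(_ x).
by rewrite subr_ge0.
Qed.

Lemma continuous_bounded_support (c : 'rV[R]_N -> R) :
  compact (msupport mu) -> continuous c ->
  exists K : R, forall x, msupport mu x -> `|c x| <= K.
Proof.
move=> cS cc.
have [K [_ cK]] : bounded_set (c @` msupport mu).
  by apply: compact_bounded; apply: continuous_compact => //;
    exact: continuous_subspaceT.
exists (`|K| + 1) => x Sx; apply: (cK (`|K| + 1)); last by exists x.
by rewrite ltr_pwDr// ler_norm.
Qed.

(** The last hypothesis on [c] says that the majorant is small on the diagonal.
    Compactness of the support turns the continuous coefficients into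
    constants, so that the error is eps plus a fixed combination of the errors
    on the test functions. *)
Lemma korovkin_cvg (A : nat -> L -> L) (J : finType) (e : J -> L)
    (g : 'rV[R]_N -> R) G :
  compact (msupport mu) ->
  (forall n, op_sublinear (A n)) -> (forall n, op_monotone (A n)) ->
  cvg_pmean (fun n => A n (Lone mu p1)) (Lone mu p1) ->
  (forall j, cvg_pmean (fun n => A n (e j)) (e j)) ->
  continuous g -> (forall y, 0 <= g y) -> {ae mu, forall x, G x = g x :> R} ->
  (forall eps : R, 0 < eps -> exists c : J -> 'rV[R]_N -> R,
    [/\ forall j, continuous (c j), forall j y, 0 <= c j y,
      forall y, {ae mu, forall x, `|(G x : R) - g y| <= \sum_j c j y * e j x} &
      {ae mu, forall x, \sum_j c j x * e j x <= eps}]) ->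
  cvg_pmean (fun n => A n G) G.
Proof.
move=> cS As Am A1 Ae cg g0 Gg Gc; apply/cvg_pmeanP/cvgr0Pnorm_le => eps eps0.
have eps20 : 0 < eps / 2 by rewrite divr_gt0.
set one := Lone mu p1.
have one0 : 0 < Lnrm one + 1 by rewrite ltr_wpDl ?Lnrm_ge0.
(* The precision eps' is chosen so that the class eps' *: one has norm at most
   eps / 2; the 1 added to the norm of one guards against the zero measure. *)
have eps'0 : 0 < eps / 2 / (Lnrm one + 1) by rewrite divr_gt0.
set eps' := eps / 2 / (Lnrm one + 1) in eps'0.
have [c [cc c0 Gce cex]] := Gc _ eps'0.
have [K gK] := continuous_bounded_support cS cg.
have /choice[C cC] := fun j => continuous_bounded_support cS (cc j).
pose D n : L := K *: Labs (A n one - one) + \sum_j C j *: Labs (A n (e j) - e j).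
have D0 : Lnrm (D n) @[n --> \oo] --> 0.
  apply: (@squeeze_cvgr _ _ _ _ (cst 0) (fun n => `|K| * Lnrm (A n one - one) +
     \sum_j `|C j| * Lnrm (A n (e j) - e j))).
  - apply: nearW => n; rewrite Lnrm_ge0/= (le_trans (LnrmD _ _))//.
    rewrite LnrmZ Lnrm_abs lerD2l (le_trans (Lnrm_sum _))//.
    by apply: ler_sum => j _; rewrite LnrmZ Lnrm_abs.
  - exact: cvg_cst.
  - have cvgMl0 (a : R) (u : nat -> L) f : cvg_pmean u f ->
        `|a| * Lnrm (u n - f) @[n --> \oo] --> 0.
      by move=> /cvg_pmeanP uf; rewrite -(mulr0 `|a|); exact: cvgM (cvg_cst _) uf.
    have sum0 : \sum_j `|C j| * Lnrm (A n (e j) - e j) @[n --> \oo] -->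
        (\sum_(j : J) 0 : R).
      apply: cvg_big => [|j _]; first exact: add_continuous.
      exact: cvgMl0 (Ae j).
    by have := cvgD (cvgMl0 K _ _ A1) sum0; rewrite big1_eq addr0; apply.
have key n : {ae mu, forall x, `|(A n G x : R) - G x| <= eps' + (D n x : R)}.
  have K1 := korovkin_pointwise (As n) (Am n) cc c0 cg g0 Gce.
  have DE : {ae mu, forall x, (D n x : R) = K * `|(A n one x : R) - one x| +
      \sum_j C j * `|(A n (e j) x : R) - e j x|}.
    have absB u v : {ae mu, forall x, Labs (u - v) x = `|(u x : R) - v x| :> R}.
      by apply: filterS2 (Labs_ae (u - v)) (LspaceB_ae u v) => x -> ->.
    have absD : {ae mu, forall x j,
        Labs (A n (e j) - e j) x = `|(A n (e j) x : R) - e j x| :> R}.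
      by apply: filter_forall => j; exact: absB.
    apply: filterS3 (ae_and absD (Lspace_lincomb_ae C (fun j => Labs (A n (e j) - e j))))
      (ae_and (LspaceZ_ae K (Labs (A n one - one))) (absB (A n one) one))
      (LspaceD_ae (K *: Labs (A n one - one))
        (\sum_j C j *: Labs (A n (e j) - e j))) => x [e1 e2] [e3 e4] ->.
    rewrite e2 e3 e4; congr (_ + _).
    by apply: eq_bigr => j _; rewrite e1.
  apply: filterS3 (ae_and K1 DE) (ae_and Gg Lone_ae)
    (ae_and cex (msupport_ae mu)) => x [h1 ->] [-> one1] [h2 Sx].
  have -> : (A n G x : R) - g x = ((A n G x : R) - g x * A n one x) +
      g x * ((A n one x : R) - one x).
    by rewrite one1 mulrBr mulr1 addrA subrK.
  apply: le_trans (ler_normD _ _) _; rewrite normrM [leRHS]addrCA [leRHS]addrC.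
  apply: lerD; last by rewrite ler_wpM2r ?gK.
  apply: (le_trans h1).
  have -> : \sum_j c j x * (A n (e j) x : R) =
      \sum_j c j x * (e j x : R) + \sum_j c j x * ((A n (e j) x : R) - e j x).
    by rewrite -big_split/=; apply: eq_bigr => j _; rewrite -mulrDr addrC subrK.
  apply: lerD h2 _; apply: ler_sum => j _; apply: le_trans (ler_norm _) _.
  by rewrite normrM ler_wpM2r ?cC.
move/cvgr0Pnorm_le : D0 => /(_ _ eps20); apply: filterS => n.
rewrite !ger0_norm ?Lnrm_ge0// => Dn.
apply: (@le_trans _ _ (Lnrm (eps' *: one + D n))).
  apply: Lnrm_le; apply: filterS3 (ae_and (key n) Lone_ae)
    (ae_and (LspaceB_ae (A n G) G) (LspaceZ_ae eps' one))
    (LspaceD_ae (eps' *: one) (D n)) => x [+ one1] [-> e1] ->.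
  by rewrite e1 one1 mulr1 => /le_trans; apply; exact: ler_norm.
apply: le_trans (LnrmD _ _) _; rewrite (splitr eps) lerD//.
rewrite LnrmZ (ger0_norm (ltW eps'0)) /eps' mulrAC ler_pdivrMr//.
by rewrite ler_wpM2l ?lerDl ?(ltW eps20).
Qed.

End korovkin.

(** * Quadratic test functions *)

Section quadratic_test.
Context (R : realType) (N : nat).
Implicit Types x y : 'rV[R]_N.

(** [inl true] and [inl false] stand for 1 and the squared norm, [inr (true, k)]
    and [inr (false, k)] for the two signs of the k-th coordinate. *)
Definition korovkin_index : finType := (bool + bool * 'I_N)%type.

Definition korovkin_fun (j : korovkin_index) x : R :=
  match j with
  | inl true => 1
  | inl false => sum_pr2 x
  | inr (true, k) => pr k x
  | inr (false, k) => - pr k x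
  end.

(** The coefficients of eps + delta |x - y|^2 in the test functions of x. The
    term -2 y_k x_k is split as (|y_k| - y_k) x_k + (|y_k| + y_k) (- x_k), whose
    coefficients are nonnegative and continuous in y. *)
Definition korovkin_coef (eps delta : R) (j : korovkin_index) y : R :=
  match j with
  | inl true => eps + delta * sum_pr2 y
  | inl false => delta
  | inr (true, k) => delta * (`|pr k y| - pr k y)
  | inr (false, k) => delta * (`|pr k y| + pr k y)
  end.

Lemma korovkin_coef_ge0 (eps delta : R) j y : 0 <= eps -> 0 <= delta ->
  0 <= korovkin_coef eps delta j y.
Proof.
move=> e0 d0; case: j => [[]|[[] k]] //=.
- by rewrite addr_ge0// mulr_ge0// sumr_ge0// => k _; rewrite sqr_ge0.
- by rewrite mulr_ge0// subr_ge0 ler_norm.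
- by rewrite mulr_ge0// -lerBlDr sub0r -normrN ler_norm.
Qed.

Lemma continuous_korovkin_coef (eps delta : R) j :
  continuous (korovkin_coef eps delta j).
Proof.
have cM (f : 'rV[R]_N -> R) : continuous f -> continuous (fun y => delta * f y).
  by move=> cf y; exact: continuousM (@cst_continuous _ _ _ _) (cf y).
have cn k : continuous (fun y : 'rV[R]_N => `|pr k y|).
  by move=> y; exact: continuous_comp (@continuous_pr _ _ k y) (@norm_continuous _ R _).
case: j => [[]|[[] k]] /=.
- have cs := cM _ (@continuous_sum_pr2 R N).
  by move=> y; exact: continuousD (@cst_continuous _ _ _ _) (cs y).
- exact: cst_continuous.
- by apply: cM => y; exact: continuousB (cn k y) (@continuous_pr _ _ k y).
- by apply: cM => y; exact: continuousD (cn k y) (@continuous_pr _ _ k y).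
Qed.

Lemma korovkin_coefE (eps delta : R) x y :
  \sum_j korovkin_coef eps delta j y * korovkin_fun j x =
  eps + delta * \sum_k (pr k x - pr k y) ^+ 2.
Proof.
rewrite big_sumType/= big_bool/=.
have -> : \sum_(i : bool * 'I_N)
      korovkin_coef eps delta (inr i) y * korovkin_fun (inr i) x =
    \sum_b \sum_k korovkin_coef eps delta (inr (b, k)) y * korovkin_fun (inr (b, k)) x.
  by rewrite pair_big/=; apply: eq_bigr => -[].
rewrite big_bool/= /sum_pr2 mulr1 -!addrA; congr (_ + _).
rewrite !mulr_sumr -!big_split/=; apply: eq_bigr => k _; ring.
Qed.

(** The norm of ['rV[R]_N] is the maximum norm; it is at most the Euclidean
    one, which is the one that the test functions see. *)
Lemma normr_sqr_le x y : `|x - y| ^+ 2 <= \sum_k (pr k x - pr k y) ^+ 2.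
Proof.
have s0 (P : pred 'I_N) : 0 <= \sum_(k | P k) (pr k x - pr k y) ^+ 2.
  by apply: sumr_ge0 => k _; rewrite sqr_ge0.
have [xy|/mx_norm_neq0 [[i k] /= xy]] := eqVneq (mx_norm (x - y)) 0.
  by rewrite [`|_|]xy expr0n/= s0.
rewrite [`|_|]xy real_normK ?num_real// ord1 !mxE (bigD1 k)//= /pr lerDl.
exact: s0.
Qed.

(** With delta = K^2 / (4 eps), the inequality K t <= eps + delta t^2 is
    (2 eps - K t)^2 >= 0. *)
Lemma korovkin_majorant (g : 'rV[R]_N -> R) (eps : R) :
  bounded_lipschitz g -> 0 < eps ->
  exists2 delta : R, 0 <= delta & forall x y,
    `|g x - g y| <= \sum_j korovkin_coef eps delta j y * korovkin_fun j x.
Proof.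
move=> [K [_ gK]] eps0; exists (K ^+ 2 / (4 * eps)).
  by rewrite divr_ge0 ?sqr_ge0// mulr_ge0// ltW.
move=> x y; rewrite korovkin_coefE; apply: le_trans (gK x y) _.
apply: (@le_trans _ _ (eps + K ^+ 2 / (4 * eps) * `|x - y| ^+ 2)).
  rewrite -subr_ge0.
  have -> : eps + K ^+ 2 / (4 * eps) * `|x - y| ^+ 2 - K * `|x - y| =
      (2 * eps - K * `|x - y|) ^+ 2 / (4 * eps).
    by field; rewrite gt_eqF.
  by rewrite divr_ge0 ?sqr_ge0// mulr_ge0// ltW.
rewrite lerD2l ler_wpM2l ?normr_sqr_le//.
by rewrite divr_ge0 ?sqr_ge0// mulr_ge0// ltW.
Qed.

End quadratic_test.

Theorem theorem5 (R : realType) (N : nat)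
    (mu : {finite_measure set (borel_rV R N) -> \bar R})
    (cS : compact (msupport mu))
    (p : R) (p1 : (1 <= p%:E)%E)
    (T : nat -> LspaceType mu p1 -> LspaceType mu p1)
    (T_sublinear : forall n, op_sublinear (T n))
    (T_monotone : forall n, op_monotone (T n))
    (T_bounded : (ereal_sup (range (fun n => opnorm (T n))) < +oo)%E)
    (T_test : forall f : LspaceType mu p1,
      test_functions cS f -> cvg_pmean (fun n => T n f) f) :
  (forall f : LspaceType mu p1, Lle 0 f -> cvg_pmean (fun n => T n f) f) /\
  ((forall n, weakly_nonlinear (T n)) ->
   forall f : LspaceType mu p1, cvg_pmean (fun n => T n f) f).
Proof.
have [M TM] : exists M : R, forall n, (opnorm (T n) <= M%:E)%E.
  have TS n : (opnorm (T n) <= ereal_sup (range (fun n => opnorm (T n))))%E.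
    by apply: ereal_sup_ubound; exists n.
  move: T_bounded TS; case: (ereal_sup _) => [r| |]//= _ TS; first by exists r.
  by exists 0 => n; apply: le_trans (TS n) _; exact: leNye.
pose e (j : korovkin_index N) : LspaceType mu p1 :=
  match j with
  | inl true => Lone mu p1
  | inl false => Lsum_pr2 p1 cS
  | inr (true, k) => Lpr p1 cS k
  | inr (false, k) => - Lpr p1 cS k
  end.
have Te j : cvg_pmean (fun n => T n (e j)) (e j).
  apply: T_test; case: j => [[]|[[] k]] /=.
  - by do 3 left.
  - by right.
  - by left; left; right; exists k.
  - by left; right; exists k.
have eE : {ae mu, forall x j, e j x = korovkin_fun j x}.
  apply: filter_forall => -[[]|[[] k]] /=.
  - exact: Lone_ae.
  - pose Lf := continuous_Lfun p1 cS (@continuous_sum_pr2 R N).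
    by apply: filterS (Lclass_ae (Lfun_Sub p1 Lf)) => x /(_ I).
  - pose Lf := continuous_Lfun p1 cS (@continuous_pr R N k).
    by apply: filterS (Lclass_ae (Lfun_Sub p1 Lf)) => x /(_ I).
  - pose Lf := continuous_Lfun p1 cS (@continuous_pr R N k).
    apply: filterS2 (Lclass_ae (Lfun_Sub p1 Lf)) (LspaceN_ae (Lpr p1 cS k)).
    move=> x /(_ I) /= prx ->.
    by congr (- _).
have T_lipschitz (g : 'rV[R]_N -> R) (G : LspaceType mu p1) : bounded_lipschitz g ->
    (forall y, 0 <= g y) -> {ae mu, forall x, G x = g x :> R} ->
    cvg_pmean (fun n => T n G) G.
  move=> bg g0 Gg.
  apply: (korovkin_cvg cS T_sublinear T_monotone (Te (inl true)) Te _ g0 Gg).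
    exact: bounded_lipschitz_continuous.
  move=> eps eps0; have [delta d0 gd] := korovkin_majorant bg eps0.
  exists (korovkin_coef eps delta); split.
  - exact: continuous_korovkin_coef.
  - by move=> j y; apply: korovkin_coef_ge0 => //; exact: ltW.
  - move=> y; apply: filterS2 Gg eE => x -> ex; apply: le_trans (gd x y) _.
    by rewrite le_eqVlt; apply/orP; left; apply/eqP/eq_bigr => j _; rewrite ex.
  - apply: filterS eE => x ex.
    rewrite (eq_bigr (fun j => korovkin_coef eps delta j x * korovkin_fun j x)).
      rewrite korovkin_coefE big1 ?mulr0 ?addr0// => k _.
      by rewrite subrr expr0n.
    by move=> j _; rewrite ex.
split=> [f f0|T_weak f].
  apply: (cvg_op_closed T_sublinear T_monotone TM) => eps eps0.
  have [g [u [bg ug fu]]] := lipschitz_dense f eps0.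
  have bg' := bounded_lipschitz_max0 bg.
  (* As f >= 0, replacing the approximant by its positive part v does not
     increase the distance to f. *)
  have [v vg] := Lspace_lift_bl mu p1 bg'.
  exists v; last by apply: T_lipschitz bg' _ vg => y; rewrite le_max lexx orbT.
  apply: le_lt_trans fu; apply: Lnrm_le.
  apply: filterS3 (ae_and ug vg) (ae_and f0 (Lspace0_ae mu p1))
    (ae_and (LspaceB_ae f v) (LspaceB_ae f u)) => x [ux vx] [+ zx] [-> ->].
  rewrite zx vx ux => fx.
  case: (leP (g x) 0) => // gx; rewrite subr0 !ger0_norm//; last first.
    by rewrite subr_ge0 (le_trans gx).
  by rewrite lerDl oppr_ge0.
apply: (cvg_op_closed T_sublinear T_monotone TM) => eps eps0.
have [g [u [bg ug fu]]] := lipschitz_dense f eps0.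
exists u => //; have [K [gK _]] := bg.
have bg' := bounded_lipschitzD bg (@bounded_lipschitz_cst R 'rV[R]_N `|K|).
set one := Lone mu p1.
(* The bound |K| of g makes u + |K| nonnegative. *)
have Tv : cvg_pmean (fun n => T n (u + `|K| *: one)) (u + `|K| *: one).
  apply: T_lipschitz bg' _ _ => [y|].
    rewrite /= -lerBlDr sub0r lerNl; apply: le_trans (ler_norm K).
    by apply: le_trans (gK y); rewrite -normrN ler_norm.
  apply: filterS3 (ae_and ug (Lone_ae mu p1)) (LspaceD_ae u (`|K| *: one))
    (LspaceZ_ae `|K| one) => x [ux onex] -> ->.
  by rewrite ux onex mulr1.
apply/cvg_pmeanP.
have sum0 : Lnrm (T n (u + `|K| *: one) - (u + `|K| *: one)) +
    `|K| * Lnrm (T n one - one) @[n --> \oo] --> (0 : R).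
  have /cvg_pmeanP Tv0 := Tv; have /cvg_pmeanP T10 := Te (inl true).
  have KT0 : `|K| * Lnrm (T n one - one) @[n --> \oo] --> (0 : R).
    by rewrite -(mulr0 `|K|); exact: cvgM (cvg_cst _) T10.
  by have := cvgD Tv0 KT0; rewrite addr0; apply.
apply: squeeze_cvgr (cvg_cst 0) sum0; apply: nearW => n.
rewrite Lnrm_ge0/=.
have -> : T n u - u = T n (u + `|K| *: one) - (u + `|K| *: one) - `|K| *: (T n one - one).
  by rewrite (T_weak n).2// opprD addrACA -scalerBr addrK.
by apply: le_trans (LnrmD _ _) _; rewrite LnrmN LnrmZ normr_id.
Qed.
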